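(* For every $c\in\mathbb{R}$ the set $\bar\Omega_n(c)=\{\bar\xi\in\bar\Omega_n : E_n(\bar\xi)\le c\}$ is compact.
   Context: Data: integers $1\le n\le m$; real numbers $u_0\le u_1<u_2<\cdots<u_m$; constants $a_i>0$, $k_i>0$ ($i=0,\ldots,m$) and $d_i\ge 0$ ($i=1,\ldots,m$), with $d_1>0$ if $u_0=u_1$; a constant $b_N<0$. Put $F(\xi)=\frac{1}{\sqrt{\pi}}\int_0^\xi e^{-s^2/4}\,ds$, with $F(+\infty)=1$. Let $\bar\Omega_n=\{\bar\xi=(\xi_1,\ldots,\xi_n)\in\mathbb{R}^n : \xi_1>\cdots>\xi_n\ge 0\}$ and, with the convention $\xi_0=+\infty$, $$E_n(\bar\xi)=-\sum_{i=0}^{n-1}k_i(u_{i+1}-u_i)\ln\bigl(F(\xi_i/a_i)-F(\xi_{i+1}/a_i)\bigr)+a_nb_N\sqrt{\pi}\,F(\xi_n/a_n)+\frac14\sum_{i=1}^n d_i\xi_i^2,\qquad\bar\xi\in\bar\Omega_n.$$ *)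

(* Defs.v *)
From HB Require Import structures.
From mathcomp Require Import all_boot all_order all_algebra.
From mathcomp Require Import all_classical all_reals all_analysis.

Set Implicit Arguments.
Unset Strict Implicit.
Unset Printing Implicit Defensive.

Import Order.TTheory GRing.Theory Num.Theory.
Import numFieldNormedType.Exports.

Local Open Scope classical_set_scope.
Local Open Scope ring_scope.

(* [Rintegral] is over a set, so orientation is handled by the case split:
   for x < 0 the integral from 0 to x is minus the integral over [x, 0]. *)
Definition oriented_integral0 (R : realType) (f : R -> R) (x : R) : R :=
  if 0 <= x then \int[@lebesgue_measure R]_(s in `[0, x]) f s
  else - \int[@lebesgue_measure R]_(s in `[x, 0]) f s.

(* The value at -oo is the limit of the odd function F; it is never used on
   the domain [Omega]. *)
Definition F (R : realType) (x : \bar R) : R :=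
  match x with
  | r%:E => (Num.sqrt pi)^-1 *
            oriented_integral0 (fun s : R => expR (- (s ^+ 2 / 4))) r
  | +oo%E => 1
  | -oo%E => -1
  end.

(* Coordinates are numbered 1, ..., n, so [xi_at xi i] is the entry of the row
   vector at the ordinal i - 1.  It is only meaningful for 1 <= i <= n. *)
Definition xi_at (R : realType) (n : nat) (xi : 'rV[R]_n) (i : nat) : R :=
  oapp (fun j : 'I_n => xi ord0 j) 0 (insub i.-1).

(* With the convention xi_0 = +oo; for 0 < b, also +oo * b^-1 = +oo. *)
Definition exi_at (R : realType) (n : nat) (xi : 'rV[R]_n) (i : nat) : \bar R :=
  if i == 0%N then +oo%E else (xi_at xi i)%:E.

Definition Omega (R : realType) (n : nat) : set 'rV[R]_n :=
  [set xi | (forall i : nat, (1 <= i < n)%N -> xi_at xi i.+1 < xi_at xi i) /\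
            0 <= xi_at xi n].

Definition E (R : realType) (u a k d : nat -> R) (bN : R) (n : nat)
    (xi : 'rV[R]_n) : R :=
  - (\sum_(0 <= i < n) k i * (u i.+1 - u i) *
       ln (F (exi_at xi i * (a i)^-1%:E)%E -
           F (exi_at xi i.+1 * (a i)^-1%:E)%E))
  + a n * bN * Num.sqrt pi * F (exi_at xi n * (a n)^-1%:E)%E
  + 4^-1 * \sum_(1 <= i < n.+1) d i * xi_at xi i ^+ 2.

(* Main.v *)
Require Import Defs.
From HB Require Import structures.
From mathcomp Require Import all_boot all_order all_algebra.
From mathcomp Require Import all_classical all_reals all_analysis.
From mathcomp Require Import ring lra.

Import Order.TTheory GRing.Theory Num.Theory.
Import numFieldNormedType.Exports.

Local Open Scope classical_set_scope.
Local Open Scope ring_scope.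

(** Why the sublevel sets are compact.  On [Omega] every difference
[F (xi_i / a_i) - F (xi_(i+1) / a_i)] is positive and at most [1], because [F]
is strictly increasing on the reals with [F 0 = 0] and supremum [1].  Hence each
logarithmic term and each quadratic term of [E] is nonnegative, while the
remaining term is at least [a_n b_N sqrt pi] since [b_N < 0] and [F < 1].  A
bound [E <= c] therefore bounds every logarithmic and every quadratic term by
one constant [C] ([E_le_terms]).

For [1 <= i < n] the weight [k_i (u_(i+1) - u_i)] is positive, so the bound on
the term keeps the [i]-th difference above a positive constant.  For [xi_1]
there are two cases: if [u_0 < u_1], the difference [1 - F (xi_1 / a_0)] stays
away from [0], and [xi_1] is bounded because [F] tends to [1] at infinity
([xi_at1_bounded]); if [u_0 = u_1], the term [d_1 xi_1 ^ 2 / 4] bounds it.  As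
[xi_1] is the largest coordinate and all are nonnegative, the sublevel set sits
in a box.

It is also closed ([closed_sublevel]): the uniform lower bounds on the
differences pass to limit points, so no two coordinates can merge in the limit;
thus a limit point is still in [Omega], where [E] is continuous, and the
inequality [E <= c] passes to it as well.

The normalisation of [F], i.e. its limit [1], is the Gaussian integral after
the change of variables [s = 2 t] ([F_cvg1]). *)

(** * The error function *)

(** Moving the base point to the left of every argument in play turns the case
split of [oriented_integral0] into an integral with fixed lower bound, to which
the fundamental theorem of calculus applies, at 0 and at negative points too. *)
Lemma oriented_integral0_shift (R : realType) (f : R -> R) (b x : R) :
  continuous f -> 0 <= b -> - b <= x ->
  oriented_integral0 f x =
  \int[@lebesgue_measure R]_(t in `[- b, x]) f t -
  \int[@lebesgue_measure R]_(t in `[- b, 0]) f t.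
Proof.
move=> cf b0 bx.
have intf (p q : R) : lebesgue_measure.-integrable `[p, q] (EFin \o f).
  apply: continuous_compact_integrable; first exact: segment_compact.
  exact: continuous_subspaceT.
have intf' (p q : R) : lebesgue_measure.-integrable `]p, q] (EFin \o f).
  apply: integrableS (intf p q) => //.
  by apply: subset_itvr; rewrite bnd_simp.
rewrite /oriented_integral0; case: ifPn => [x0|]; last rewrite -ltNge => x0.
  rewrite Rintegral_itvB ?bnd_simp//; last by rewrite oppr_le0.
  by rewrite Rintegral_itv_obnd_cbnd.
rewrite -[RHS]opprB Rintegral_itvB ?bnd_simp//; last exact: ltW.
by rewrite Rintegral_itv_obnd_cbnd.
Qed.

Lemma is_derive_oriented_integral0 (R : realType) (f : R -> R) (x : R) :
  continuous f -> is_derive x 1 (oriented_integral0 f) (f x).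
Proof.
move=> cf; pose b := `|x| + 1.
have b0 : 0 <= b by rewrite addr_ge0.
have bx : - b < x by rewrite ltrNl (le_lt_trans (ler_norm _))// normrN ltrDl.
have xx1 : x < x + 1 by rewrite ltrDl.
have intf : lebesgue_measure.-integrable `[- b, x + 1] (EFin \o f).
  apply: continuous_compact_integrable; first exact: segment_compact.
  exact: continuous_subspaceT.
have [dI I'] := continuous_FTC1_closed xx1 intf bx (cf x).
rewrite derive1E in I'.
have dI' := DeriveDef dI I'.
apply: (near_eq_is_derive (f := fun y =>
  \int[@lebesgue_measure R]_(t in `[- b, y]) f t -
  \int[@lebesgue_measure R]_(t in `[- b, 0]) f t)).
  near=> y; rewrite (@oriented_integral0_shift _ _ b)//.
  by near: y; apply: cvgr_ge bx; exact: cvg_id.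
by apply: is_derive_eq; rewrite subr0.
Unshelve. all: by end_near. Qed.

Lemma continuous_gauss_quarter (R : realType) :
  continuous (fun s : R => expR (- (s ^+ 2 / 4))).
Proof.
move=> s; apply: (@continuous_comp _ _ _ (fun s : R => - (s ^+ 2 / 4)) expR).
  apply: cvgN; apply: cvgMr_tmp; exact: exprn_continuous.
exact: continuous_expR.
Qed.

Lemma is_derive_F (R : realType) (x : R) :
  is_derive x 1 (fun r : R => F r%:E)
    ((Num.sqrt pi)^-1 * expR (- (x ^+ 2 / 4))).
Proof.
have h := is_derive_oriented_integral0 _ _ x (@continuous_gauss_quarter R).
exact: (is_deriveZ _ h).
Qed.

Lemma continuous_F (R : realType) : continuous (fun r : R => F r%:E).
Proof.
move=> x; apply/differentiable_continuous/derivable1_diffP.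
by have [] := is_derive_F _ x.
Qed.

Lemma F0 (R : realType) : F (0%:E : \bar R) = 0.
Proof.
by rewrite /F /oriented_integral0 lexx set_itv1 Rintegral_set1 mulr0.
Qed.

Lemma F_lt (R : realType) (x y : R) : x < y -> F x%:E < F y%:E.
Proof.
move=> xy.
apply: (@gtr0_derive1_incr R (fun r => F r%:E) x y) => //.
- by move=> t _; have [] := is_derive_F _ t.
- move=> t _; rewrite derive1E.
  have [_ ->] := is_derive_F _ t.
  by rewrite mulr_gt0 ?expR_gt0// invr_gt0 sqrtr_gt0 pi_gt0.
- by apply: continuous_subspaceT; exact: continuous_F.
Qed.

(** The integral of [exp (- s^2 / 4)] from 0 to [r] is twice that of the Gaussian
from 0 to [r / 2]: both sides have the same derivative in [r] and vanish at 0.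
What is left is the limit of the Gaussian integral, known through its square
because that is how the Gaussian integral is computed. *)
Lemma F_cvg1 (R : realType) : F (x%:E : \bar R) @[x --> +oo] --> (1 : R).
Proof.
have cg := @continuous_gauss_fun R.
pose G := oriented_integral0 (@gauss_fun R).
have FE r : F r%:E = (Num.sqrt pi)^-1 * (2 * G (r / 2)).
  rewrite /F; congr (_ * _); apply/eqP; rewrite -subr_eq0; apply/eqP.
  (* the difference of the two sides, shown to be constant *)
  pose D r :=
    oriented_integral0 (fun s : R => expR (- (s ^+ 2 / 4))) r -
    2 * G (r / 2).
  have dD (x : R) : is_derive x 1 D 0.
    have h1 := is_derive_oriented_integral0 _ _ x (@continuous_gauss_quarter R).
    have h2 : is_derive x 1 (fun r : R => G (r / 2)) (gauss_fun (x / 2) * 2^-1).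
      have hG := is_derive_oriented_integral0 _ _ (x / 2) cg.
      apply: (@is_derive1_comp R G (fun r : R => r / 2)).
      by apply: is_derive_eq; rewrite !scaler0 add0r /GRing.scale/= mulr1.
    apply: (is_derive_eq (is_deriveB h1 (is_deriveZ 2 h2))); rewrite /gauss_fun.
    rewrite /GRing.scale/= mulrCA divff// mulr1 expr_div_n -natrX.
    exact: subrr.
  rewrite -[LHS]/(D r) (is_derive_0_is_cst r 0 dD).
  by rewrite /D /G /oriented_integral0 mul0r lexx set_itv1 !Rintegral_set1 mulr0
    subrr.
have cvgG : G x @[x --> +oo] --> Num.sqrt pi / 2.
  have : Num.sqrt (@gauss_integral_proof.integral0_gauss R x ^+ 2)
      @[x --> +oo] --> Num.sqrt (pi / 4).
    apply: continuous_cvg; first exact: sqrt_continuous.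
    exact: gauss_integral_proof.cvg_integral0_gauss_sqr.
  rewrite sqrtrM ?pi_ge0// sqrtrV// (_ : 4 = 2 ^+ 2); last by rewrite -natrX.
  rewrite sqrtr_sqr ger0_norm//; apply: cvg_trans; apply: near_eq_cvg.
  near=> x; rewrite /G /oriented_integral0 ifT; last first.
    by near: x; exact: nbhs_pinfty_ge.
  rewrite sqrtr_sqr ger0_norm//.
  exact: gauss_integral_proof.integral0_gauss_ge0.
have -> : (fun x : R => F x%:E) =
    (fun r => (Num.sqrt pi)^-1 * (2 * G (r / 2))) by exact/funext.
have sp : Num.sqrt pi != 0 :> R by rewrite gt_eqF// sqrtr_gt0 pi_gt0.
have e1 : (Num.sqrt pi)^-1 * (2 * (Num.sqrt pi / 2)) = 1 :> R by field.
rewrite -[X in _ --> X]e1.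
have cvgG2 : G (x / 2) @[x --> +oo] --> Num.sqrt pi / 2.
  apply: (cvg_comp (fun r : R => r / 2) G) cvgG.
  by apply: gt0_cvgMly => //; exact: cvg_id.
by apply: cvgMl_tmp; apply: cvgMl_tmp.
Unshelve. all: by end_near. Qed.

Lemma F_lt1 (R : realType) (x : R) : F x%:E < 1.
Proof.
apply: (@lt_le_trans _ _ (F (x + 1)%:E)); first by apply: F_lt; rewrite ltrDl.
rewrite -[leRHS](cvg_lim _ (@F_cvg1 R))//; apply: limr_ge.
  by apply/cvg_ex; exists 1; exact: F_cvg1.
near=> y; apply/ltW/F_lt; near: y.
by apply: nbhs_pinfty_gt; exact: num_real.
Unshelve. all: by end_near. Qed.

Lemma F_ge0 (R : realType) (x : R) : 0 <= x -> 0 <= F x%:E.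
Proof.
rewrite le_eqVlt => /predU1P[<-|/F_lt/ltW]; first by rewrite F0.
by rewrite F0.
Qed.

(** * Finite sums *)

Lemma cvg_sum_nat (R : realType) (T : Type) (G : set_system T) (FG : Filter G)
    (m n : nat) (f : nat -> T -> R) (l : nat -> R) :
  (forall i, (m <= i < n)%N -> f i x @[x --> G] --> l i) ->
  \sum_(m <= i < n) f i x @[x --> G] --> \sum_(m <= i < n) l i.
Proof.
move=> fl; rewrite big_nat; under eq_fun do rewrite big_nat.
by apply: cvg_big => //; exact: add_continuous.
Qed.

Lemma ge0_ler_sum_nat (R : realType) (m n j : nat) (f : nat -> R) :
  (forall i, (m <= i < n)%N -> 0 <= f i) -> (m <= j < n)%N ->
  f j <= \sum_(m <= i < n) f i.
Proof.
move=> f0 jmn; rewrite (bigD1_seq j) ?mem_index_iota ?iota_uniq//= lerDl.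
rewrite big_seq_cond; apply: sumr_ge0 => i /andP[+ _].
by rewrite mem_index_iota => /f0.
Qed.

(** * The arguments of the logarithms *)

Definition gap (R : realType) (a : nat -> R) (n : nat) (xi : 'rV[R]_n)
    (i : nat) : R :=
  F (exi_at xi i * (a i)^-1%:E)%E - F (exi_at xi i.+1 * (a i)^-1%:E)%E.

Lemma gap0 (R : realType) (a : nat -> R) (n : nat) (xi : 'rV[R]_n) :
  0 < a 0%N -> gap R a n xi 0 = 1 - F (xi_at xi 1 / a 0%N)%:E.
Proof. by move=> a0; rewrite /gap /exi_at/= gt0_mulye// lte_fin invr_gt0. Qed.

Lemma gapS (R : realType) (a : nat -> R) (n : nat) (xi : 'rV[R]_n) (i : nat) :
  (0 < i)%N ->
  gap R a n xi i = F (xi_at xi i / a i)%:E - F (xi_at xi i.+1 / a i)%:E.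
Proof. by case: i. Qed.

Lemma continuous_xi_at (R : realType) (n i : nat) :
  continuous (fun xi : 'rV[R]_n => xi_at xi i).
Proof.
rewrite /xi_at; case: insub => [j|] /=; first exact: coord_continuous.
exact: cst_continuous.
Qed.

Lemma continuous_F_xi_at (R : realType) (n i : nat) (b : R) :
  continuous (fun xi : 'rV[R]_n => F (xi_at xi i / b)%:E).
Proof.
move=> xi; apply: (@continuous_comp _ _ _ (fun y : 'rV[R]_n => xi_at y i / b)
  (fun r : R => F r%:E)); last exact: continuous_F.
by apply: (@cvgMr_tmp _ _ (nbhs xi)); exact: continuous_xi_at.
Qed.

Lemma continuous_gap (R : realType) (a : nat -> R) (n i : nat) :
  0 < a i -> continuous (fun xi : 'rV[R]_n => gap R a n xi i).
Proof.
case: i => [|i] ai0; last first.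
  by move=> xi; apply: (@cvgB _ _ _ (nbhs xi)); exact: continuous_F_xi_at.
have -> : (fun xi : 'rV[R]_n => gap R a n xi 0) =
    (fun xi => 1 - F (xi_at xi 1 / a 0%N)%:E) by
  apply/funext => xi; exact: gap0.
move=> xi; apply: (@cvgB _ _ _ (nbhs xi)); first exact: cvg_cst.
exact: continuous_F_xi_at.
Qed.

Lemma Omega_le (R : realType) (n : nat) (xi : 'rV[R]_n) (i j : nat) :
  Omega xi -> (1 <= i <= j)%N -> (j <= n)%N -> xi_at xi j <= xi_at xi i.
Proof.
move=> [dec _] /andP[i1]; elim: j => [|j IH]; first by case: i i1.
rewrite leq_eqVlt ltnS => /predU1P[->//|ij] jn.
apply: le_trans (IH ij (ltnW jn)); apply/ltW/dec.
by rewrite jn (leq_trans i1 ij).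
Qed.

Lemma Omega_ge0 (R : realType) (n : nat) (xi : 'rV[R]_n) (i : nat) :
  Omega xi -> (1 <= i <= n)%N -> 0 <= xi_at xi i.
Proof.
move=> xiO iin; apply: (le_trans xiO.2); exact: Omega_le.
Qed.

Lemma gap_le1 (R : realType) (a : nat -> R) (n : nat) (xi : 'rV[R]_n)
    (i : nat) :
  Omega xi -> (i < n)%N -> 0 < a i -> gap R a n xi i <= 1.
Proof.
move=> xiO lin ai0; have x0 : 0 <= F (xi_at xi i.+1 / a i)%:E.
  by apply: F_ge0; rewrite divr_ge0 ?(ltW ai0)//; exact: Omega_ge0.
case: i lin ai0 x0 => [|i] lin ai0 x0; first by rewrite gap0// gerBl.
by rewrite gapS// lerBlDr ler_wpDr// ltW// F_lt1.
Qed.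

Lemma gap_gt0 (R : realType) (a : nat -> R) (n : nat) (xi : 'rV[R]_n)
    (i : nat) :
  Omega xi -> (i < n)%N -> 0 < a i -> 0 < gap R a n xi i.
Proof.
move=> xiO lin ai0; case: i lin ai0 => [|i] lin ai0.
  by rewrite gap0// subr_gt0 F_lt1.
rewrite gapS// subr_gt0; apply: F_lt; rewrite ltr_pM2r ?invr_gt0//.
by apply: xiO.1.
Qed.

(** * The functional *)

(** Membership in [Omega] keeps the arguments of the logarithms positive, where
[ln] is continuous. *)
Lemma continuous_E (R : realType) (u a k d : nat -> R) (bN : R) (n : nat)
    (xi : 'rV[R]_n) :
  (0 < n)%N -> (forall i, (i < n)%N -> 0 < a i) -> Omega xi ->
  {for xi, continuous (@E R u a k d bN n)}.
Proof.
move=> n0 a0 xiO; rewrite /E.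
apply: (@cvgD _ _ _ (nbhs xi)); [apply: (@cvgD _ _ _ (nbhs xi))|].
- apply: (@cvgN _ _ _ (nbhs xi)); apply: cvg_sum_nat => i /= lin.
  apply: (@cvgMl_tmp _ _ (nbhs xi)).
  apply: (@continuous_comp _ _ _ (fun y : 'rV[R]_n => gap R a n y i) (@ln R)).
    by apply: continuous_gap; exact: a0.
  by apply: continuous_ln; apply: gap_gt0 => //; exact: a0.
- apply: (@cvgMl_tmp _ _ (nbhs xi)); case: n n0 xi xiO {a0} => // n _ xi _.
  exact: continuous_F_xi_at.
- apply: (@cvgMl_tmp _ _ (nbhs xi)); apply: cvg_sum_nat => i _.
  apply: (@cvgMl_tmp _ _ (nbhs xi)).
  apply: (@continuous_comp _ _ _ (fun y : 'rV[R]_n => xi_at y i)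
    (fun r : R => r ^+ 2)); first exact: continuous_xi_at.
  exact: exprn_continuous.
Qed.

(** All terms but the middle one are nonnegative on [Omega], and the middle one
is at least [a n * bN * sqrt pi]; so [C], what [c] leaves once this lower bound
is subtracted, dominates each of the others. *)
Lemma E_le_terms (R : realType) (u a k d : nat -> R) (bN c : R) (n : nat)
    (xi : 'rV[R]_n) :
  (0 < n)%N -> (forall i, (i <= n)%N -> 0 < a i) ->
  (forall i, (i < n)%N -> 0 <= k i * (u i.+1 - u i)) ->
  (forall i, (1 <= i <= n)%N -> 0 <= d i) -> bN < 0 ->
  Omega xi -> E u a k d bN xi <= c ->
  let C := c - a n * bN * Num.sqrt pi in
  (forall i, (i < n)%N -> k i * (u i.+1 - u i) * - ln (gap R a n xi i) <= C) /\
  (forall i, (1 <= i <= n)%N -> 4^-1 * (d i * xi_at xi i ^+ 2) <= C).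
Proof.
move=> n0 a0 w0 d0 bN0 xiO Ec C.
pose S1 := \sum_(0 <= i < n) k i * (u i.+1 - u i) * - ln (gap R a n xi i).
pose S2 := \sum_(1 <= i < n.+1) 4^-1 * (d i * xi_at xi i ^+ 2).
have t1 i : (0 <= i < n)%N -> 0 <= k i * (u i.+1 - u i) * - ln (gap R a n xi i).
  move=> /= lin; rewrite mulr_ge0 ?w0// oppr_ge0 ln_le0// gap_le1//.
  by apply: a0; exact: ltnW.
have t2 i : (1 <= i < n.+1)%N -> 0 <= 4^-1 * (d i * xi_at xi i ^+ 2).
  by move=> iin; apply: mulr_ge0; rewrite ?invr_ge0// mulr_ge0 ?sqr_ge0 ?d0.
have S1_ge0 : 0 <= S1 by rewrite /S1 big_nat; exact: sumr_ge0.
have S2_ge0 : 0 <= S2 by rewrite /S2 big_nat; exact: sumr_ge0.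
have drift : a n * bN * Num.sqrt pi <=
    a n * bN * Num.sqrt pi * F (exi_at xi n * (a n)^-1%:E)%E.
  rewrite -[leLHS]mulr1; apply: ler_wnM2l.
    rewrite nmulr_rle0 ?sqrtr_ge0// pmulr_rlt0//; exact: a0.
  case: n n0 xi {a0 w0 d0 xiO Ec C S1 S2 t1 t2 S1_ge0 S2_ge0} => // n _ xi.
  by rewrite ltW// F_lt1.
have ES : S1 + a n * bN * Num.sqrt pi + S2 <= c.
  apply: le_trans Ec; rewrite /E -/(gap _ _ _ _ _) mulr_sumr -/S2 lerD2r.
  rewrite lerD// /S1 -sumrN le_eqVlt; apply/orP; left; apply/eqP.
  by apply: eq_bigr => i _; rewrite mulrN.
split=> i lin.
  have := @ge0_ler_sum_nat R 0 n i _ t1 lin; rewrite -/S1 /C; lra.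
have := @ge0_ler_sum_nat R 1 n.+1 i _ t2 lin; rewrite -/S2 /C; lra.
Qed.

Lemma expR_le_of_ln_term (R : realType) (w C x : R) :
  0 < w -> 0 < x -> w * - ln x <= C -> expR (- (C / w)) <= x.
Proof.
move=> w0 x0 h; rewrite -[leRHS]lnK ?posrE// ler_expR lerNl.
by rewrite ler_pdivlMr// mulrC.
Qed.

(** Beyond a point where [F] exceeds [1 - delta], the gap [1 - F] would be less
than [delta]. *)
Lemma xi_at1_bounded (R : realType) (a : nat -> R) (n : nat) (delta : R) :
  0 < a 0%N -> 0 < delta ->
  exists M, forall xi : 'rV[R]_n, delta <= gap R a n xi 0 -> xi_at xi 1 <= M.
Proof.
move=> a0 d0.
have /cvgr_gt/(_ (1 - delta)) := @F_cvg1 R.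
rewrite gtrBl d0 => /(_ isT) [T [_ FT]].
have {}FT : 1 - delta < F (T + 1)%:E by apply: FT; rewrite ltrDl.
exists ((T + 1) * a 0%N) => xi; rewrite gap0// => dx.
rewrite leNgt -ltr_pdivlMr//; apply/negP => /F_lt Tx.
lra.
Qed.

(** The bounds [delta] are what makes the set closed although [Omega] in general
is not: a weak inequality between continuous functions survives in the limit,
and [delta i > 0] gives back the strict inequality between consecutive
coordinates. *)
Lemma closed_sublevel (R : realType) (u a k d : nat -> R) (bN c : R) (n : nat)
    (delta : nat -> R) :
  (0 < n)%N -> (forall i, (i < n)%N -> 0 < a i) ->
  (forall i, (1 <= i < n)%N -> 0 < delta i) ->
  (forall xi : 'rV[R]_n, Omega xi -> E u a k d bN xi <= c ->
     forall i, (1 <= i < n)%N -> delta i <= gap R a n xi i) ->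
  closed [set xi : 'rV[R]_n | Omega xi /\ E u a k d bN xi <= c].
Proof.
move=> n0 a0 delta0 gapd xi clxi; set S := [set _ | _] in clxi.
have cont_ge (f : 'rV[R]_n -> R) (b : R) : {for xi, continuous f} ->
    (forall y, S y -> b <= f y) -> b <= f xi.
  move=> cf Sf; rewrite leNgt; apply/negP => fb.
  have [y [Sy /= fy]] := clxi _ (cvgr_lt _ cf _ fb).
  by have := Sf _ Sy; rewrite leNgt fy.
have xiO : Omega xi.
  split=> [i lin|]; last first.
    by apply: cont_ge (@continuous_xi_at R n n xi) _ => y [[]].
  have ai0 : 0 < a i by apply: a0; case/andP: lin.
  have : delta i <= gap R a n xi i.
    apply: (cont_ge (fun y => gap R a n y i)); first exact: continuous_gap.
    by move=> y [Oy Ey]; exact: gapd.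
  move=> /(lt_le_trans (delta0 _ lin)); rewrite gapS; last by case/andP: lin.
  rewrite subr_gt0 => Flt; rewrite ltNge; apply/negP.
  rewrite le_eqVlt => /predU1P[xx|xx]; first by rewrite xx ltxx in Flt.
  suff /(lt_trans Flt) : F (xi_at xi i / a i)%:E < F (xi_at xi i.+1 / a i)%:E.
    by rewrite ltxx.
  by apply: F_lt; rewrite ltr_pM2r ?invr_gt0.
split=> //; rewrite -lerN2; apply: (cont_ge (fun y => - E u a k d bN y)).
  by apply: (@cvgN _ _ _ (nbhs xi)); exact: continuous_E.
by move=> y [_ Ey]; rewrite lerN2.
Qed.

Theorem proposition3p1 (R : realType) (n m : nat) (u a k d : nat -> R) (bN : R)
  (hn : (1 <= n)%N) (hnm : (n <= m)%N)
  (hu01 : u 0%N <= u 1%N)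
  (hu : forall i : nat, (1 <= i < m)%N -> u i < u i.+1)
  (ha : forall i : nat, (i <= m)%N -> 0 < a i)
  (hk : forall i : nat, (i <= m)%N -> 0 < k i)
  (hd : forall i : nat, (1 <= i <= m)%N -> 0 <= d i)
  (hd1 : u 0%N = u 1%N -> 0 < d 1%N)
  (hbN : bN < 0) :
  forall c : R,
    compact [set xi : 'rV[R]_n | Omega xi /\ E u a k d bN xi <= c].
Proof.
move=> c; pose w i := k i * (u i.+1 - u i).
pose C := c - a n * bN * Num.sqrt pi.
have a0 i : (i <= n)%N -> 0 < a i by move=> lin; apply/ha/(leq_trans lin).
have wS i : (1 <= i < n)%N -> 0 < w i.
  move=> /andP[i1 lin]; have lim := leq_trans lin hnm.
  by rewrite mulr_gt0 ?hk ?(ltnW lim)// subr_gt0 hu// i1.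
have w0 i : (i < n)%N -> 0 <= w i.
  case: i => [|i] lin; last by apply/ltW/wS.
  by rewrite mulr_ge0 ?subr_ge0// ltW// hk.
have d0 i : (1 <= i <= n)%N -> 0 <= d i.
  by move=> /andP[i1 lin]; rewrite hd// i1 (leq_trans lin).
have terms (xi : 'rV[R]_n) : Omega xi -> E u a k d bN xi <= c -> _ :=
  @E_le_terms R u a k d bN c n xi hn a0 w0 d0 hbN.
have gapd (xi : 'rV[R]_n) i : Omega xi -> E u a k d bN xi <= c ->
    (i < n)%N -> 0 < w i -> expR (- (C / w i)) <= gap R a n xi i.
  move=> xiO Ec lin wi; apply: expR_le_of_ln_term => //; last first.
    exact: (terms _ xiO Ec).1.
  by apply: gap_gt0 => //; apply: a0; exact: ltnW.
have [M xiM] : exists M, forall xi : 'rV[R]_n,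
    Omega xi -> E u a k d bN xi <= c -> xi_at xi 1 <= M.
  move: hu01; rewrite le_eqVlt => /predU1P[u01|u01].
    (* [x ^+ 2 <= 4 * C / d 1] from the term of [d 1], and [x <= x ^+ 2 + 1] *)
    exists (4 * C / d 1%N + 1) => xi xiO Ec.
    have d1 := hd1 u01.
    have := (terms _ xiO Ec).2 1%N; rewrite hn => /(_ isT).
    rewrite -/C; set x := xi_at xi 1 => dx.
    have : x ^+ 2 <= 4 * C / d 1%N by rewrite ler_pdivlMr//; lra.
    by nra.
  have wpos : 0 < w 0%N by rewrite mulr_gt0 ?hk// subr_gt0.
  have [M hM] :=
    @xi_at1_bounded R a n _ (a0 0%N isT) (expR_gt0 (- (C / w 0%N))).
  by exists M => xi xiO Ec; apply: hM; exact: gapd.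
apply: (@subclosed_compact _ _
  [set v : 'rV[R]_n | forall i, v ord0 i \in `[0, M]]).
- apply: (@closed_sublevel R u a k d bN c n
    (fun i => expR (- (C / w i)))) => //.
  + by move=> i lin; apply: a0; exact: ltnW.
  + by move=> i _; exact: expR_gt0.
  + by move=> xi xiO Ec i /[dup] /andP[_ lin] /wS; exact: gapd.
- apply: (@rV_compact _ _ (fun=> `[0, M]%classic)) => _.
  exact: segment_compact.
- move=> xi [xiO Ec] i.
  have -> : xi ord0 i = xi_at xi i.+1 by rewrite /xi_at/= valK.
  rewrite in_itv/= Omega_ge0//=.
  by apply: le_trans (xiM _ xiO Ec); exact: Omega_le.
Qed.
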